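(* Let $G$ be a finite non-solvable group and let $n=|G|-|Sol(G)|$. Then there is no element $x\in G\setminus Sol(G)$ such that $\deg(x)=n-2$.
   Context: For a finite group $G$ and $x\in G$, the solvabilizer of $x$ is $Sol_G(x)=\{y\in G : \langle x,y\rangle \text{ is solvable}\}$, and $Sol(G)=\{x\in G : \langle x,y\rangle \text{ is solvable for all } y\in G\}$ (it is known that $Sol(G)$ equals the solvable radical $R(G)$ of $G$). The non-solvable graph $\mathcal{S}_G$ is the simple graph with vertex set $G$ in which two distinct elements $x,y$ are adjacent if and only if $\langle x,y\rangle$ is not solvable. $\widehat{\mathcal{S}_G}$ is the induced subgraph of $\mathcal{S}_G$ on $G\setminus Sol(G)$. For $x\in G\setminus Sol(G)$, $\deg(x)$ denotes the degree of $x$ in $\mathcal{S}_G$, which equals its degree in $\widehat{\mathcal{S}_G}$ and equals $|G|-|Sol_G(x)|$. *)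

(* Defs.v *)
From HB Require Import structures.
From mathcomp Require Import all_boot all_fingroup all_solvable.

Set Implicit Arguments.
Unset Strict Implicit.
Unset Printing Implicit Defensive.

Local Open Scope group_scope.

Definition Sol (gT : finGroupType) (G : {set gT}) : {set gT} :=
  [set x in G | [forall y in G, solvable <<[set x; y]>>]].

(* Adjacency of the simple graph with vertex set G, as a relation on the
   ambient type that relates no element outside G. *)
Definition nonsolvable_graph (gT : finGroupType) (G : {set gT}) : rel gT :=
  [rel x y | [&& x \in G, y \in G, x != y & ~~ solvable <<[set x; y]>>]].

Definition deg (T : finType) (e : rel T) (x : T) : nat := #|[set y | e x y]|.

(* Main.v *)
Require Import Defs.
From mathcomp Require Import all_boot all_fingroup all_solvable.
From mathcomp Require Import all_character.

(* If deg x = n - 2 then exactly two elements x, t outside Sol G generate a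
   solvable group with x.  Conjugates of x are outside Sol G, so the conjugacy
   class of x cannot be made of elements y with <x, y> solvable: otherwise it
   lies in {x, t}, it generates a solvable normal subgroup, and x is in Sol G.

   If x^2 = y^2 then x inverts x^-1 y and <x, y> is solvable; so x^2 is not
   central, and x is not an involution.  Hence t = x^-1, any y with <x, y>
   solvable normalises <x>, and the solvabilizer of x is the subgroup
   N = 'N_G(<x>), which is Sol G plus two elements.  If #|Sol G| > 2, the normal
   subset Sol G generates N, so N is normal and contains the class of x.  If
   #|Sol G| = 2, then Sol G = {1, x^2} and x^2 is central.  If Sol G = 1, then
   N = {1, x, x^-1} = <x> has order 3 and is its own normaliser, so it is a
   Frobenius complement; it normalises a nontrivial Sylow subgroup of the
   Frobenius kernel, which must then be contained in the solvabilizer <x>.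
   The theorem that Sol G is the solvable radical is not used. *)

Local Open Scope group_scope.

Section Solvabilizer.

Set Implicit Arguments.
Unset Strict Implicit.
Unset Printing Implicit Defensive.

Variable gT : finGroupType.
Implicit Types (x y : gT) (G H : {group gT}).

Definition solvabilizer (G : {set gT}) x : {set gT} :=
  [set y in G | solvable <<[set x; y]>>].

(** * Solvability of two-generated subgroups *)

Lemma solvable_cycle x : solvable <[x]>.
Proof. by rewrite abelian_sol ?cycle_abelian. Qed.

Lemma solvable_pairS H x y :
  solvable H -> x \in H -> y \in H -> solvable <<[set x; y]>>.
Proof.
move=> solH Hx Hy; apply: solvableS solH.
by rewrite gen_subG subUset !sub1set Hx.
Qed.

(** [H] is a solvable normal subgroup of [H <*> <[y]>] with cyclic quotient. *)
Lemma solvable_pair_norm H x y :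
  solvable H -> x \in H -> y \in 'N(H) -> solvable <<[set x; y]>>.
Proof.
move=> solH Hx nHy; have nHY : <[y]> \subset 'N(H) by rewrite cycle_subG.
apply: (@solvable_pairS (H <*> <[y]>)).
- rewrite (@series_sol _ _ H) ?solH /=; last first.
    by rewrite /normal joing_subl join_subG normG.
  by rewrite quotientYidl // quotient_sol ?solvable_cycle.
- by rewrite (subsetP (joing_subl _ _)).
by rewrite (subsetP (joing_subr _ _)) // cycle_id.
Qed.

Lemma solvable_pair_sqr x y : x ^+ 2 = y ^+ 2 -> solvable <<[set x; y]>>.
Proof.
move=> eq2; set r := x^-1 * y.
have rx : r ^ x = r^-1.
  (* After left multiplication by [x ^+ 2], which is also [y ^+ 2], both sides equal [y * x]. *)
  rewrite /r conjgE invMg invgK; apply: (mulgI (x ^+ 2)).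
  by rewrite [in RHS]eq2 !expg2 -!mulgA !mulKVg.
have nrx : x \in 'N(<[r]>).
  by rewrite inE -cycleJ rx cycleV.
have := solvable_pair_norm (solvable_cycle r) (cycle_id r) nrx.
have rG : r \in <<[set r; x]>> by rewrite mem_gen ?set21.
have xG : x \in <<[set r; x]>> by rewrite mem_gen ?set22.
move/solvable_pairS; apply => //.
by rewrite -(mulKVg x y) groupM.
Qed.

(** * Closure properties of [Sol G] *)

Lemma mem_SolP G x :
  reflect (x \in G /\ {in G, forall y, solvable <<[set x; y]>>}) (x \in Sol G).
Proof.
rewrite inE; apply: (iffP andP) => [[Gx /forall_inP]|[Gx solx]] //.
by split=> //; apply/forall_inP.
Qed.

Lemma Sol_sub G : Sol G \subset G.
Proof. by apply/subsetP=> x /mem_SolP[]. Qed.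

Lemma Sol1 G : 1 \in Sol G.
Proof.
apply/mem_SolP; split=> // y Gy.
by apply: (@solvable_pairS <[y]>); rewrite ?cycle_id ?solvable_cycle.
Qed.

Lemma SolV G x : (x^-1 \in Sol G) = (x \in Sol G).
Proof.
suff imp z : z \in Sol G -> z^-1 \in Sol G.
  by apply/idP/idP=> /imp; rewrite ?invgK.
case/mem_SolP=> Gz solz; apply/mem_SolP; split=> [|y Gy].
  by rewrite groupV.
by apply: solvable_pairS (solz y Gy) _ _; rewrite ?groupV mem_gen ?set21 ?set22.
Qed.

Lemma SolJ G x g : g \in G -> (x ^ g \in Sol G) = (x \in Sol G).
Proof.
suff imp z h : h \in G -> z \in Sol G -> z ^ h \in Sol G.
  move=> Gg; apply/idP/idP=> [|/imp]; last exact.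
  by move/(imp _ g^-1); rewrite groupV conjgK; apply.
move=> Gh /mem_SolP[Gz solz]; apply/mem_SolP; split=> [|y Gy].
  by rewrite groupJ.
have := solz (y ^ h^-1); rewrite groupJ ?groupV // => /(_ isT) sol1.
rewrite (_ : [set z ^ h; y] = [set z; y ^ h^-1] :^ h).
  by rewrite genJ -(isog_sol (conj_isog _ h)).
by rewrite /conjugate imsetU1 imset_set1 conjgKV.
Qed.

Lemma norm_Sol G : G \subset 'N(Sol G).
Proof.
apply/subsetP=> g Gg; rewrite inE; apply/subsetP=> _ /imsetP[x Sx ->].
by rewrite SolJ.
Qed.

(** * Solvabilizers *)

Lemma mem_solvabilizer G x : x \in G -> x \in solvabilizer G x.
Proof.
move=> Gx; rewrite inE Gx.
by apply: (@solvable_pairS <[x]>); rewrite ?cycle_id ?solvable_cycle.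
Qed.

Lemma Sol_sub_solvabilizer G x : x \in G -> Sol G \subset solvabilizer G x.
Proof.
move=> Gx; apply/subsetP=> y /mem_SolP[Gy soly]; rewrite inE Gy.
by rewrite setUC soly.
Qed.

Lemma norm_cycle_sub_solvabilizer G x : 'N_G(<[x]>) \subset solvabilizer G x.
Proof.
apply/subsetP=> y /setIP[Gy nxy]; rewrite inE Gy.
by apply: (@solvable_pair_norm <[x]>); rewrite ?cycle_id ?solvable_cycle.
Qed.

Lemma class_not_sub_solvabilizer G x :
    x \in G :\: Sol G -> #|solvabilizer G x :\: Sol G| = 2 ->
  ~~ (x ^: G \subset solvabilizer G x).
Proof.
case/setDP=> Gx nSx cT; apply/negP=> sxG.
have [t defT] : exists t, solvabilizer G x :\: Sol G = [set x; t].
  have /cards2P[a [b [_ defT]]] : #|solvabilizer G x :\: Sol G| == 2.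
    by apply/eqP.
  have : x \in solvabilizer G x :\: Sol G.
    by rewrite in_setD mem_solvabilizer ?nSx.
  by rewrite defT => /set2P[]->; [exists b | exists a; rewrite setUC].
have solT : solvable <<[set x; t]>>.
  have : t \in solvabilizer G x :\: Sol G by rewrite defT set22.
  by case/setDP; rewrite inE => /andP[].
have sol_class : solvable <<x ^: G>>.
  apply: solvableS solT; rewrite genS // -defT.
  apply/subsetP=> _ /imsetP[g Gg ->].
  by rewrite in_setD SolJ // nSx (subsetP sxG) ?memJ_class.
case/negP: nSx; apply/mem_SolP; split=> // y Gy.
apply: solvable_pair_norm sol_class _ _; first by rewrite mem_gen ?class_refl.
by rewrite (subsetP (norm_gen _)) // (subsetP (class_norm x G)).
Qed.

(** * Exactly two extra elements in a solvabilizer *)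

Section TwoExtraElements.

Variables (G : {group gT}) (x : gT).
Hypotheses (GSx : x \in G :\: Sol G)
  (cardT : #|solvabilizer G x :\: Sol G| = 2).

Let Gx : x \in G. Proof. by case/setDP: GSx. Qed.
Let nSx : x \notin Sol G. Proof. by case/setDP: GSx. Qed.

Let x_neq1 : x != 1.
Proof. by apply: (contraNneq _ nSx) => ->; apply: Sol1. Qed.

Lemma sqr_not_central : ~~ [forall g in G, (x ^+ 2) ^ g == x ^+ 2].
Proof.
apply: (contraNN _ (class_not_sub_solvabilizer GSx cardT)) => /forall_inP cx2.
apply/subsetP=> _ /imsetP[g Gg ->]; rewrite inE groupJ //=.
by apply: solvable_pair_sqr; rewrite -conjXg (eqP (cx2 g Gg)).
Qed.

Lemma sqr_neq1 : x ^+ 2 != 1.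
Proof.
apply: (contraNN _ sqr_not_central) => /eqP->.
by apply/forall_inP=> g _; rewrite conj1g.
Qed.

Lemma neq_invg : x != x^-1.
Proof.
apply: (contraNN _ sqr_neq1) => /eqP def_x.
by rewrite expg2 {2}def_x mulgV.
Qed.

Lemma solvabilizer_diff_Sol : solvabilizer G x :\: Sol G = [set x; x^-1].
Proof.
apply/esym/eqP; rewrite eqEcard cardT cards2 neq_invg andbT.
rewrite subUset !sub1set !in_setD SolV nSx mem_solvabilizer //=.
apply: (subsetP (norm_cycle_sub_solvabilizer G x)).
by rewrite inE groupV Gx groupV (subsetP (normG _)) ?cycle_id.
Qed.

(** If [<x, y>] is solvable, so is its subgroup [<x, x ^ y>]; hence [x ^ y] is again an extra
    element, namely [x] or [x^-1]. *)
Lemma solvabilizer_norm_cycle : solvabilizer G x = 'N_G(<[x]>).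
Proof.
apply/eqP; rewrite eqEsubset norm_cycle_sub_solvabilizer andbT.
apply/subsetP=> y; rewrite inE => /andP[Gy solxy]; rewrite inE Gy.
have : x ^ y \in solvabilizer G x :\: Sol G.
  rewrite in_setD SolJ // nSx inE groupJ //=.
  by apply: solvable_pairS solxy _ _; rewrite ?groupJ ?mem_gen ?set21 ?set22.
rewrite solvabilizer_diff_Sol => T_xy; rewrite inE -cycleJ.
by case/set2P: T_xy => ->; rewrite ?cycleV subxx.
Qed.

Lemma card_norm_cycle : #|'N_G(<[x]>)| = #|Sol G| + 2.
Proof.
rewrite -solvabilizer_norm_cycle -cardT -(cardsID (Sol G) (solvabilizer G x)).
by rewrite (setIidPr (Sol_sub_solvabilizer Gx)).
Qed.

Lemma card_Sol_le2 : #|Sol G| <= 2.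
Proof.
rewrite leqNgt.
apply: (contraNN _ (class_not_sub_solvabilizer GSx cardT)) => S_gt2.
have sSN : <<Sol G>> \subset 'N_G(<[x]>).
  by rewrite gen_subG /= -solvabilizer_norm_cycle Sol_sub_solvabilizer.
have defN : <<Sol G>> = 'N_G(<[x]>).
  apply/eqP; rewrite eqEsubset sSN -indexg_eq1.
  (* An index of at least 2 gives [#|<<Sol G>>| * 2 <= #|Sol G| + 2 <= #|<<Sol G>>| + 2], so
     [#|<<Sol G>>| <= 2]. *)
  apply/idPn=> index_neq1.
  have := Lagrange sSN; rewrite card_norm_cycle => cN.
  have index_gt1 : 1 < #|'N_G(<[x]>) : <<Sol G>>|.
    by rewrite ltn_neqAle eq_sym index_neq1 indexg_gt0.
  have := leq_mul (leqnn #|<<Sol G>>|) index_gt1; rewrite cN => le_2S.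
  have le_S_genS := subset_leq_card (sub_gen (subxx (Sol G))).
  have := leq_trans le_2S (leq_add le_S_genS (leqnn 2)).
  rewrite muln2 -addnn leq_add2l leqNgt.
  by rewrite (leq_trans S_gt2).
apply/subsetP=> _ /imsetP[g Gg ->]; rewrite solvabilizer_norm_cycle -defN.
rewrite memJ_norm; last first.
  by rewrite (subsetP (norm_gen _)) // (subsetP (norm_Sol G)).
by rewrite defN -solvabilizer_norm_cycle mem_solvabilizer.
Qed.

Lemma card_Sol_neq2 : #|Sol G| != 2.
Proof.
apply: (contraNN _ sqr_not_central) => /eqP S2.
have cN := card_norm_cycle; rewrite S2 in cN.
have Nx : x \in 'N_G(<[x]>).
  by rewrite -solvabilizer_norm_cycle mem_solvabilizer.
have Sx2 : x ^+ 2 \in Sol G.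
  have : x ^+ 2 \in solvabilizer G x by rewrite solvabilizer_norm_cycle groupX.
  apply: contraLR => nSx2; apply/negP=> Tx2.
  have : x ^+ 2 \in [set x; x^-1].
    by rewrite -solvabilizer_diff_Sol in_setD nSx2.
  (* [x ^+ 2 = x] forces [x = 1]; if [x ^+ 2 = x^-1], the order of [x] divides both 3 and
     [#|'N_G(<[x]>)| = 4]. *)
  case/set2P=> /eqP.
    by rewrite expg2 -{3}[x]mulg1 (inj_eq (mulgI x)) (negPf x_neq1).
  rewrite eq_sym eq_invg_mul -expgS => x3.
  have : #[x] %| gcdn 3 4.
    by rewrite dvdn_gcd order_dvdn x3 -[4]cN order_dvdG.
  by rewrite dvdn1 order_eq1 (negPf x_neq1).
have defS : Sol G = [set 1; x ^+ 2].
  apply/esym/eqP; rewrite eqEcard S2 cards2 eq_sym sqr_neq1 andbT.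
  by rewrite subUset !sub1set Sol1.
apply/forall_inP=> g Gg; have : (x ^+ 2) ^ g \in Sol G by rewrite SolJ.
by rewrite defS => /set2P[/eqP|->//]; rewrite conjg_eq1 (negPf sqr_neq1).
Qed.

Lemma Sol_eq1 : Sol G = 1.
Proof.
apply/esym/eqP; rewrite eqEcard sub1set Sol1 cards1.
by have := card_Sol_le2; rewrite leq_eqVlt (negPf card_Sol_neq2).
Qed.

Lemma card_norm_cycle3 : #|'N_G(<[x]>)| = 3.
Proof. by rewrite card_norm_cycle Sol_eq1 cards1. Qed.

Lemma norm_cycle_self : 'N_G(<[x]>) = <[x]>.
Proof.
have sxN : <[x]> \subset 'N_G(<[x]>).
  by rewrite cycle_subG inE Gx (subsetP (normG _)) ?cycle_id.
apply/esym/eqP; rewrite eqEcard sxN.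
have := cardSg sxN; rewrite card_norm_cycle3 dvdn_divisors // !inE.
case/orP=> /eqP ox; last by rewrite ox.
by case/negP: sqr_neq1; rewrite -order_dvdn orderE ox.
Qed.

(** As [<[x]>] has prime order, each nontrivial element generates it; so any [g] in [G] conjugating
    one of them into [<[x]>] normalises [<[x]>], and thus lies in it. *)
Lemma cycle_Frobenius : ~~ solvable G -> [Frobenius G with complement <[x]>].
Proof.
move=> nsolG; apply/andP; split.
  by apply: contraNneq nsolG => <-; apply: solvable_cycle.
have pr_x : prime #|<[x]>| by rewrite -norm_cycle_self card_norm_cycle3.
apply/normedTI_memJ_P; split.
- by apply/set0Pn; exists x; rewrite !inE cycle_id x_neq1.
- by rewrite cycle_subG.
move=> a g /setD1P[nt_a xa] Gg; apply/idP/idP=> [|xg]; last first.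
  rewrite memJ_norm; first by rewrite !inE nt_a.
  by rewrite normD1 (subsetP (normG _)).
case/setD1P=> nt_ag xag; rewrite /= -norm_cycle_self inE Gg inE.
have gen_x b : b \in <[x]> -> b != 1 -> <[b]> = <[x]>.
  move=> xb ntb; apply/eqP; rewrite eqEsubset cycle_subG xb.
  rewrite prime_meetG //; apply/trivgPn; exists b => //.
  by rewrite inE xb cycle_id.
by rewrite -{1}(gen_x a) // -cycleJ gen_x ?subxx.
Qed.

Lemma two_extra_elements_sol : solvable G.
Proof.
apply/idPn=> nsolG.
have [K frobG] := Frobenius_kernel_exists (cycle_Frobenius nsolG).
have [defG ntK _ _ _] := Frobenius_context frobG.
have [_ _ nKx tiKx] := sdprodP defG.
(* The prime is chosen to divide [#|K|], so that [Q] is nontrivial. *)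
have [Q sylQ nQx] :=
  sol_coprime_Sylow_exists (pdiv #|K|) (solvable_cycle x) nKx
    (Frobenius_coprime frobG).
have sQx : Q \subset 'N_G(<[x]>).
  rewrite -solvabilizer_norm_cycle; apply/subsetP=> q Qq; rewrite inE.
  have [_ /mulG_sub[sKG _] _ _] := sdprodP defG.
  rewrite (subsetP sKG) ?(subsetP (pHall_sub sylQ)) //= setUC.
  apply: solvable_pair_norm (pgroup_sol (pHall_pgroup sylQ)) Qq _.
  by rewrite -cycle_subG.
have : Q :==: 1.
  by rewrite -subG1 -tiKx subsetI (pHall_sub sylQ) /= -norm_cycle_self.
apply/negP; rewrite -cardG_gt1 (card_Hall sylQ) p_part_gt1 pi_pdiv.
by rewrite cardG_gt1.
Qed.

End TwoExtraElements.

Lemma deg_nonsolvable_graph G x : x \in G ->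
  deg (nonsolvable_graph G) x = #|G :\: solvabilizer G x|.
Proof.
move=> Gx; apply: eq_card => y; rewrite !inE /nonsolvable_graph /= Gx /=.
case Gy: (y \in G) => //=; rewrite andbT.
(* Nonsolvability of [<x, y>] already forces [x != y]. *)
apply: andb_idl; apply: contraNneq => <-.
by have := mem_solvabilizer Gx; rewrite inE => /andP[].
Qed.

(** This makes the subtraction [n - 2] exact; a neighbour of [x] in the graph is the second
    element. *)
Lemma card_diff_Sol_ge2 G x : x \in G :\: Sol G -> 2 <= #|G :\: Sol G|.
Proof.
move=> GSx; have [Gx nSx] := setDP GSx.
have [y Gy nsol] : exists2 y, y \in G & ~~ solvable <<[set x; y]>>.
  by apply/exists_inP; rewrite -negb_forall_in; move: nSx; rewrite inE Gx.
have nSy : y \notin Sol G.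
  by apply: (contraNN _ nsol) => /mem_SolP[_ soly]; rewrite setUC soly.
have neq_xy : x != y.
  apply: contraNneq nsol => <-.
  by have := mem_solvabilizer Gx; rewrite inE => /andP[].
have <- : #|[set x; y]| = 2 by rewrite cards2 neq_xy.
by rewrite subset_leq_card // subUset !sub1set GSx in_setD nSy.
Qed.

End Solvabilizer.

(* Neither subtraction truncates when G :\: Sol G is inhabited: if <x, y> is
   not solvable then x, y and x * y are distinct elements of G :\: Sol G. *)
Theorem theorem4p2 (gT : finGroupType) (G : {group gT})
    (nsolG : ~~ solvable G) :
  let n := (#|G| - #|Sol G|)%N in
  ~ exists x : gT, x \in G :\: Sol G /\ deg (nonsolvable_graph G) x = (n - 2)%N.
Proof.
move=> n [x [GSx degx]]; case/negP: nsolG.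
have [Gx nSx] := setDP GSx.
apply: (two_extra_elements_sol GSx).
have def_n : n = #|G :\: Sol G| by rewrite cardsD (setIidPr (Sol_sub G)).
have n_ge2 : 2 <= n by rewrite def_n (card_diff_Sol_ge2 GSx).
have sVG : solvabilizer G x \subset G by apply/subsetP=> y /setIdP[].
rewrite deg_nonsolvable_graph // cardsD (setIidPr sVG) in degx.
rewrite cardsD (setIidPr (Sol_sub_solvabilizer Gx)).
(* Write 2 as [n - (n - 2)] and replace [n - 2] by the degree [#|G| - #|solvabilizer G x|]. *)
by rewrite -(subKn n_ge2) -degx /n subnAC subKn // subset_leq_card.
Qed.
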